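(* Fix $\eta>0$. There is a constant $C>0$ depending only on $\eta$ such that the following holds for every $\delta>0$ and every $\delta$-isoradial graph with rhombi angles in $[\eta,\pi-\eta]$. Let $\Omega^\delta_\diamondsuit$ be a simply connected discrete domain and let $w\in\mathrm{Int}\,\Omega^\delta_{\Gamma^*}$ be an inner face surrounded by inner vertices $u_s\in\mathrm{Int}\,\Omega^\delta_\Gamma$ and faces $w_s\in\Omega^\delta_{\Gamma^*}$, $s=1,\dots,n$. If $F:\Omega^\delta_\diamondsuit\to\mathbb C$ is s-holomorphic and $H$ is defined by $$H(u)-H(w')=2\delta\cdot\big|\mathrm{Proj}\big[F(z);[i(w'-u)]^{-\frac12}\big]\big|^2$$ for every edge $[uw']$ ($u\in\Gamma$, $w'\in\Gamma^*$) of a rhombus with center $z\in\Omega^\delta_\diamondsuit$, then $$\max_{s=1,\dots,n}H(u_s)-H(w)\le C\cdot\Big(H(w)-\min_{s=1,\dots,n}H(w_s)\Big).$$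
   Context: **Lattice.** A planar graph $\Gamma$ embedded in $\mathbb C$ is $\delta$-isoradial if each face is inscribed in a circle of radius $\delta$; the circle centers are assumed to lie inside the faces and are the vertices of the dual graph $\Gamma^*$ (faces of $\Gamma$ are identified with vertices of $\Gamma^*$). $\Lambda=\Gamma\cup\Gamma^*$, with edges $[uw]$ joining $u\in\Gamma$ to the center $w\in\Gamma^*$ of an incident face; the faces of $\Lambda$ are rhombi with side $\delta$, and $\diamondsuit$ is the set of rhombi centers. For $w\in\Gamma^*$: $u_1,\dots,u_n$ are the vertices of the face $w$ in cyclic order, and $w_s$ are the neighbors of $w$ in $\Gamma^*$, so that $wu_sw_su_{s+1}$ are the rhombi around $w$. **Discrete domains.** A simply connected discrete domain $\Omega^\delta_\diamondsuit\subset\diamondsuit$ corresponds to a simply connected polygonal domain $\Omega^\delta$ composed of rhombi and boundary half-rhombi (triangles cut off from rhombi by a diagonal lying on $\partial\Omega^\delta$); $\Omega^\delta_\diamondsuit$ is the set of centers of these. $\Omega^\delta_\Gamma,\Omega^\delta_{\Gamma^*}$ are the sets of vertices of the rhombi with centers in $\Omega^\delta_\diamondsuit$; $\mathrm{Int}\,\Omega^\delta_\Gamma$, $\mathrm{Int}\,\Omega^\delta_{\Gamma^*}$ are the vertices in the interior of $\Omega^\delta$. $z_0\sim z_1$ if the (half-)rhombi share an edge of $\Lambda$. **s-holomorphicity.** $\mathrm{Proj}[X;u]=\frac X2+\frac{\overline Xu^2}{2|u|^2}$ is the orthogonal projection of $X$ on $u\mathbb R$. $F$ is s-holomorphic if $\mathrm{Proj}[F(z_0);[i(w-u)]^{-1/2}]=\mathrm{Proj}[F(z_1);[i(w-u)]^{-1/2}]$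 for all $z_0\sim z_1$ in $\Omega^\delta_\diamondsuit$ with common edge $[uw]$, $u\in\Gamma$, $w\in\Gamma^*$. (For such $F$ the function $H$ is well defined up to an additive constant.) *)

(* Defs.v *)
From mathcomp Require Import all_boot all_order all_algebra.
From mathcomp Require Import complex.
From mathcomp Require Import all_classical all_reals all_analysis.
Set Implicit Arguments.
Unset Strict Implicit.
Unset Printing Implicit Defensive.
Import Order.TTheory GRing.Theory Num.Theory.
Import numFieldNormedType.Exports.
Local Open Scope classical_set_scope.
Local Open Scope complex_scope.
Local Open Scope ring_scope.

(** [R[i]] carries no topology of its own; seen as an abstract
    [numClosedFieldType] it inherits the metric topology of its norm. *)
Definition plane (R : realType) : numClosedFieldType := R[i].

(** ** Plane geometry *)

Definition segment (R : realType) (a b : plane R) : set (plane R) :=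
  [set p | exists2 t : R, 0 <= t <= 1 & p = a + t%:C * (b - a)].

(** Convex combinations with positive weights: for three or more points in
    convex position, the open polygon they span. *)
Definition open_hull (R : realType) (n : nat) (p : 'I_n -> plane R) :
    set (plane R) :=
  [set z | exists c : 'I_n -> R,
    [/\ forall i, 0 < c i,
        \sum_(i < n) c i = 1 &
        z = \sum_(i < n) (c i)%:C * p i]].

Definition open_triangle (R : realType) (a b c : plane R) : set (plane R) :=
  open_hull (tnth [tuple a; b; c]).

Definition open_quad (R : realType) (a b c d : plane R) : set (plane R) :=
  open_hull (tnth [tuple a; b; c; d]).

Definition angle (R : realType) (a b : plane R) : R :=
  acos (complex.Re (a * b^* / (`|a| * `|b|))).

Definition boundary (R : realType) (A : set (plane R)) : set (plane R) :=
  closure A `\` interior A.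

Definition path_connected (R : realType) (A : set (plane R)) : Prop :=
  forall x y, A x -> A y -> exists g : R -> plane R,
    [/\ {within `[0, 1], continuous g}, g 0 = x, g 1 = y &
        forall t : R, t \in `[0, 1] -> A (g t)].

(** Every loop in [A] is homotopic to a constant, within [A] and with fixed
    base point. *)
Definition loops_contractible (R : realType) (A : set (plane R)) : Prop :=
  forall g : R -> plane R,
    {within `[0, 1], continuous g} ->
    (forall t : R, t \in `[0, 1] -> A (g t)) ->
    g 0 = g 1 ->
    exists h : R * R -> plane R,
      [/\ {within [set st : R * R | (st.1 \in `[0, 1]) && (st.2 \in `[0, 1])],
             continuous h},
          forall s t : R, s \in `[0, 1] -> t \in `[0, 1] -> A (h (s, t)),
          forall t : R, t \in `[0, 1] -> h (0, t) = g t,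
          forall t : R, t \in `[0, 1] -> h (1, t) = g 0 &
          forall s : R, s \in `[0, 1] -> h (s, 0) = g 0 /\ h (s, 1) = g 0].

Definition simply_connected (R : realType) (A : set (plane R)) : Prop :=
  [/\ A !=set0, path_connected A & loops_contractible A].

(** ** Isoradial graphs *)

(** A plane graph; its edges are straight because the faces considered below
    are polygons inscribed in circles. *)
Record plane_graph (R : realType) := PlaneGraph {
  vertex : set (plane R);
  edge : plane R -> plane R -> Prop;
  edge_vertex : forall u v, edge u v -> vertex u;
  edge_sym : forall u v, edge u v -> edge v u;
  edge_irr : forall u, ~ edge u u;
  edge_avoids_vertex : forall u v x,
    edge u v -> vertex x -> segment u v x -> x = u \/ x = v;
  edge_planar : forall u v u' v' p,
    edge u v -> edge u' v' -> segment u v p -> segment u' v' p ->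
    [\/ u = u' /\ v = v', u = v' /\ v = u' |
        (p = u \/ p = v) /\ (p = u' \/ p = v')]
}.

Definition skeleton (R : realType) (G : plane_graph R) : set (plane R) :=
  vertex G `|` [set p | exists u v, edge G u v /\ segment u v p].

Definition is_face (R : realType) (G : plane_graph R) (f : set (plane R)) :
    Prop :=
  exists2 p, ~ skeleton G p & f = connected_component (~` skeleton G) p.

(** [u] lists, counterclockwise, distinct points of the circle of center [w]
    and radius [delta]. *)
Definition cyclic_on_circle (R : realType) (delta : R) (w : plane R)
    (n : nat) (u : 'I_n.+3 -> plane R) : Prop :=
  exists alpha : 'I_n.+3 -> R,
    [/\ forall s t : 'I_n.+3, (s < t)%N -> alpha s < alpha t,
        alpha ord_max < alpha ord0 + 2 * pi &
        forall s, u s = w + delta%:C * (cos (alpha s) +i* sin (alpha s))].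

(** [w], as a vertex of the dual graph: the face with successive vertices [u]
    is inscribed in the circle of center [w] and radius [delta], and contains
    [w]. *)
Definition inscribed_face (R : realType) (G : plane_graph R) (delta : R)
    (w : plane R) (n : nat) (u : 'I_n.+3 -> plane R) : Prop :=
  [/\ is_face G (open_hull u),
      forall s, edge G (u s) (u (ordS s)),
      cyclic_on_circle delta w u &
      open_hull u w].

Definition isoradial (R : realType) (G : plane_graph R) (delta : R) : Prop :=
  forall f, is_face G f ->
    exists w n (u : 'I_n.+3 -> plane R),
      f = open_hull u /\ inscribed_face G delta w u.

Definition incident_face (R : realType) (G : plane_graph R) (delta : R)
    (w u u' : plane R) : Prop :=
  exists n (v : 'I_n.+3 -> plane R) s,
    inscribed_face G delta w v /\
    (v s = u /\ v (ordS s) = u' \/ v s = u' /\ v (ordS s) = u).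

(** The rhombus with diagonals the edge [u u'] of the graph and the dual edge
    [w w']; its sides are [u w], [w u'], [u' w'], [w' u]. *)
Definition rhombus (R : realType) (G : plane_graph R) (delta : R)
    (u w u' w' : plane R) : Prop :=
  [/\ incident_face G delta w u u', incident_face G delta w' u u' & w <> w'].

Definition rhombi_angles_in (R : realType) (G : plane_graph R)
    (delta a b : R) : Prop :=
  forall u w u' w', rhombus G delta u w u' w' ->
    a <= angle (u - w) (u' - w) <= b /\ a <= angle (w - u) (w' - u) <= b.

Definition center (R : realType) (u u' : plane R) : plane R := (u + u') / 2.

(** ** Discrete domains

    A discrete domain is given by the polygonal domain [Om] in the plane; its
    tiles are the (half-)rhombi that [Om] cuts out. *)

(** The diagonal [b c] cuts from the rhombus [Q] the half [a b c] lying in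
    [Om]. *)
Definition half_tile (R : realType) (Om Q : set (plane R))
    (a b c : plane R) : Prop :=
  Q `&` Om = open_triangle a b c /\ segment b c `<=` boundary Om.

Definition tile (R : realType) (Om : set (plane R)) (u w u' w' : plane R) :
    set (plane R) :=
  closure (open_quad u w u' w' `&` Om).

Definition tiled (R : realType) (Om : set (plane R)) (u w u' w' : plane R) :
    Prop :=
  let Q := open_quad u w u' w' in
  [\/ Q `&` Om = set0,
      Q `<=` Om,
      half_tile Om Q u w w' \/ half_tile Om Q u' w w' |
      half_tile Om Q w u u' \/ half_tile Om Q w' u u'].

Definition discrete_domain (R : realType) (G : plane_graph R) (delta : R)
    (Om : set (plane R)) : Prop :=
  [/\ open Om,
      forall u w u' w', rhombus G delta u w u' w' -> tiled Om u w u' w' &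
      Om = interior [set p | exists u w u' w',
                       rhombus G delta u w u' w' /\ tile Om u w u' w' p]].

(** [rhombus_in G delta Om u w u' w']: the rhombus has its center in the
    discrete domain. *)
Definition rhombus_in (R : realType) (G : plane_graph R) (delta : R)
    (Om : set (plane R)) (u w u' w' : plane R) : Prop :=
  rhombus G delta u w u' w' /\ open_quad u w u' w' `&` Om !=set0.

Definition dom_vertex (R : realType) (G : plane_graph R) (delta : R)
    (Om : set (plane R)) : set (plane R) :=
  [set u | exists w u' w', rhombus_in G delta Om u w u' w'].

Definition dom_dual (R : realType) (G : plane_graph R) (delta : R)
    (Om : set (plane R)) : set (plane R) :=
  [set w | exists u u' w', rhombus_in G delta Om u w u' w'].

Definition int_dom_vertex (R : realType) (G : plane_graph R) (delta : R)
    (Om : set (plane R)) : set (plane R) :=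
  dom_vertex G delta Om `&` interior Om.

Definition int_dom_dual (R : realType) (G : plane_graph R) (delta : R)
    (Om : set (plane R)) : set (plane R) :=
  dom_dual G delta Om `&` interior Om.

(** [z] is the center of a (half-)rhombus of the domain having [u w] among its
    sides; for a half-rhombus the sides beyond the cutting diagonal are thus
    left out. *)
Definition tile_side (R : realType) (G : plane_graph R) (delta : R)
    (Om : set (plane R)) (z u w : plane R) : Prop :=
  exists u' w', [/\ rhombus_in G delta Om u w u' w', z = center u u' &
                    segment u w `<=` tile Om u w u' w'].

(** ** s-holomorphicity *)

Definition Proj (R : realType) (X u : plane R) : plane R :=
  X / 2 + X^* * u ^+ 2 / (2 * `|u| ^+ 2).

(** The projection does not depend on the choice of the square root. *)
Definition edge_dir (R : realType) (u w : plane R) : plane R :=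
  (sqrtC ('i * (w - u)))^-1.

(** Only the values of [F] at the centers of the tiles of [Om] matter. *)
Definition s_holomorphic (R : realType) (G : plane_graph R) (delta : R)
    (Om : set (plane R)) (F : plane R -> plane R) : Prop :=
  forall z0 z1 u w,
    tile_side G delta Om z0 u w -> tile_side G delta Om z1 u w ->
    Proj (F z0) (edge_dir u w) = Proj (F z1) (edge_dir u w).

Definition primitive_of_square (R : realType) (G : plane_graph R) (delta : R)
    (Om : set (plane R)) (F : plane R -> plane R) (H : plane R -> R) : Prop :=
  forall z u w, tile_side G delta Om z u w ->
    H u - H w = 2 * delta * complex.Re (`|Proj (F z) (edge_dir u w)| ^+ 2).

(* Main.v *)
(** Let [A s] be the argument of [u_s - w] and [x_s] the coordinate of
    [Proj F(z_s)] along [cis (pi / 4 - A s / 2)], the direction attached to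
    the edge [u_s w].  By s-holomorphicity [x_s] and [x_(s+1)] are two
    coordinates of the single number [F(z_s)], along directions at angle
    [theta_s = (A (s+1) - A s) / 2]; since that angle is in
    [[eta / 2, pi / 2 - eta / 2]], they determine [F(z_s)].  The directions
    attached to [u_s w_s] and [u_(s+1) w] are orthogonal, so
    [H(u_s) - H(w) = 2 delta x_s^2] and
    [H(w) - H(w_s) = 2 delta (|F(z_s)|^2 - x_s^2 - x_(s+1)^2)], where the last
    bracket is
    [cos theta (cos theta (x_s^2 + x_(s+1)^2) - 2 x_s x_(s+1)) / sin^2 theta].
    After a full turn around [w] the direction has turned by [-pi], hence
    [x_N = - x_0] and the [x_s] change sign somewhere.  There the bracket
    dominates [x_s^2]; elsewhere it bounds [x_(s+1)^2] in terms of [x_s^2],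
    and as [N eta <= 2 pi] the bound survives the tour around [w]. *)

Require Import Defs.
From mathcomp Require Import all_boot all_order all_algebra.
From mathcomp Require Import complex ring lra.
From mathcomp Require Import all_classical all_reals all_analysis.
Import Order.TTheory GRing.Theory Num.Theory.
Import numFieldNormedType.Exports.
Local Open Scope classical_set_scope.
Local Open Scope complex_scope.
Local Open Scope ring_scope.

(** * Quadratic forms and antiperiodic sequences *)

(** The square of [k * y - 2 * x] absorbs the cross term: 2kxy <= k^2 y^2 / 2 + 2x^2. As S^2 <= 1,
    this leaves k^2 y^2 <= 2M + 4x^2 <= 6B. *)
Lemma quadratic_form_step (R : realFieldType) (c k S M B x y : R) :
  0 < c <= k -> k ^+ 2 + S ^+ 2 = 1 -> 0 <= M ->
  k * (k * (x ^+ 2 + y ^+ 2) - 2 * (x * y)) <= M * S ^+ 2 ->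
  M <= B -> x ^+ 2 <= B -> y ^+ 2 <= 6 / c ^+ 2 * B.
Proof.
move=> /andP[c0 ck] kS M0 hM MB xB.
have c2 : 0 < c ^+ 2 by rewrite exprn_gt0.
rewrite mulrAC ler_pdivlMr //.
have ck2 : c ^+ 2 <= k ^+ 2 by rewrite lerXn2r // nnegrE; lra.
have hy : c ^+ 2 * y ^+ 2 <= k ^+ 2 * y ^+ 2 by rewrite ler_wpM2r // sqr_ge0.
have hS : M * S ^+ 2 <= M by rewrite ler_piMr //; have := sqr_ge0 k; lra.
have hx : 0 <= k ^+ 2 * x ^+ 2 by rewrite -exprMn sqr_ge0.
have := sqr_ge0 (k * y - 2 * x).
rewrite sqrrB !exprMn => hsq; lra.
Qed.

(** When [x * y] is nonpositive the cross term only helps, so k^2 x^2 <= M S^2. The sign of [M] is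
    thus deduced, not assumed. *)
Lemma quadratic_form_sign_change (R : realFieldType) (c k S M x y : R) :
  0 < c <= k -> k ^+ 2 + S ^+ 2 = 1 -> 0 < S ->
  k * (k * (x ^+ 2 + y ^+ 2) - 2 * (x * y)) <= M * S ^+ 2 ->
  x * y <= 0 -> 0 <= M /\ c ^+ 2 * x ^+ 2 <= M.
Proof.
move=> /andP[c0 ck] kS S0 hM xy.
have k0 : 0 < k by apply: lt_le_trans ck.
have ck2 : c ^+ 2 <= k ^+ 2 by rewrite lerXn2r // nnegrE; lra.
have hx : c ^+ 2 * x ^+ 2 <= k ^+ 2 * x ^+ 2 by rewrite ler_wpM2r // sqr_ge0.
have hx0 : 0 <= c ^+ 2 * x ^+ 2 by rewrite -exprMn sqr_ge0.
have hy0 : 0 <= k ^+ 2 * y ^+ 2 by rewrite -exprMn sqr_ge0.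
have kxy : k * (x * y) <= 0 by rewrite pmulr_rle0.
have MS : c ^+ 2 * x ^+ 2 <= M * S ^+ 2 by lra.
have M0 : 0 <= M.
  have S2 : 0 < S ^+ 2 by rewrite exprn_gt0.
  by rewrite -(pmulr_lge0 _ S2); exact: le_trans hx0 MS.
split=> //; apply: le_trans MS _.
by rewrite ler_piMr //; have := sqr_ge0 k; lra.
Qed.

(** Otherwise every term would have the strict sign of [x 0], including [x N = - x 0]. *)
Lemma antiperiodic_sign_change (R : realFieldType) (N : nat) (x : nat -> R) :
  (0 < N)%N -> x N = - x 0%N -> exists2 j, (j < N)%N & x j * x j.+1 <= 0.
Proof.
move=> N0 xN; apply: contrapT => nj.
have pos j : (j < N)%N -> 0 < x j * x j.+1.
  by move=> jN; rewrite ltNge; apply/negP => hj; apply: nj; exists j.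
have x0 : x 0%N != 0.
  by apply/eqP => x0; have := pos _ N0; rewrite x0 mul0r ltxx.
have ind j : (j <= N)%N -> 0 < x 0%N * x j.
  elim: j => [|j IH] jN; first by rewrite -expr2 exprn_even_gt0.
  have p1 := IH (ltnW jN); have p2 := pos _ jN.
  have : 0 < x 0%N * x j.+1 * (x j ^+ 2).
    by have := mulr_gt0 p1 p2; congr (_ < _); ring.
  rewrite pmulr_lgt0 // exprn_even_gt0 //=; apply/eqP => xj.
  by move: p1; rewrite xj mulr0 ltxx.
have := ind _ (leqnn N).
by rewrite xN mulrN -expr2 oppr_gt0 ltNge sqr_ge0.
Qed.

(* A sign change is the only place where the form bounds [x j] outright; from
   there the bound is carried once around the cycle. *)
Lemma antiperiodic_bound (R : realFieldType) (c M : R) (N : nat)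
    (x k S : nat -> R) :
  (0 < N)%N -> x N = - x 0%N -> 0 < c ->
  (forall s, (s < N)%N ->
    [/\ c <= k s, 0 < S s, k s ^+ 2 + S s ^+ 2 = 1 &
        k s * (k s * (x s ^+ 2 + x s.+1 ^+ 2) - 2 * (x s * x s.+1))
          <= M * S s ^+ 2]) ->
  0 <= M /\
  forall t, (t <= N)%N -> x t ^+ 2 <= (6 / c ^+ 2) ^+ (2 * N).+1 * M.
Proof.
move=> N0 xN c0 hyp.
have [j jN xj] := @antiperiodic_sign_change _ _ _ N0 xN.
have [ck S0 kS hM] := hyp _ jN.
have [|M0 xjM] := @quadratic_form_sign_change _ c _ _ _ _ _ _ kS S0 hM xj.
  by rewrite c0.
split=> //.
set L := 6 / c ^+ 2.
have c2 : 0 < c ^+ 2 by rewrite exprn_gt0.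
have L1 : 1 <= L.
  rewrite ler_pdivlMr // mul1r.
  have : c ^+ 2 <= k j ^+ 2 by rewrite lerXn2r // nnegrE; lra.
  by have := sqr_ge0 (S j); lra.
have prop i a B : (i + a <= N)%N -> M <= B -> x i ^+ 2 <= B ->
    x (i + a)%N ^+ 2 <= L ^+ a * B.
  move=> + MB xB; elim: a => [|a IH] iaN; first by rewrite addn0 mul1r.
  rewrite addnS in iaN *.
  have [ck' S0' kS' hM'] := hyp _ iaN.
  rewrite [L ^+ _]exprS -mulrA.
  apply: (@quadratic_form_step _ c _ _ M _ _ _ _ kS' M0 hM').
  - by rewrite c0.
  - apply: (le_trans MB); rewrite ler_peMl ?exprn_ege1 //.
    exact: le_trans M0 MB.
  - exact: IH (ltnW iaN).
have xjL : x j ^+ 2 <= L * M.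
  rewrite /L mulrAC ler_pdivlMr // mulrC; lra.
have LM : M <= L * M by rewrite ler_peMl.
have Lmon a b : (a <= b)%N -> L ^+ a * M <= L ^+ b * M.
  by move=> ab; rewrite ler_wpM2r // ler_weXn2l.
(* Squares do not see the sign in [x N = - x 0], so the bound at [N] passes to 0. One factor [L] at
   [j], at most [N] steps up to [N] and at most [N] more from 0 make the exponent 2N + 1. *)
have x0 : x 0%N ^+ 2 <= L ^+ N.+1 * M.
  have jNj : (j + (N - j) = N)%N by rewrite subnKC // ltnW.
  rewrite -sqrrN -xN -[in x N]jNj.
  apply: le_trans (prop _ _ _ _ LM xjL) _; first by rewrite jNj.
  by rewrite mulrA -exprSr Lmon // ltnS leq_subr.
move=> t tN; rewrite -[t]add0n.
apply: le_trans (prop _ _ _ _ _ x0) _ => //.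
  by have := @Lmon 0%N N.+1 isT; rewrite expr0 mul1r.
rewrite mulrA -exprD Lmon // addnS ltnS mul2n -addnn leq_add2r //.
Qed.


(** * Unit complex numbers and projections on lines *)

Definition cis {R : realType} (t : R) : plane R := cos t +i* sin t.

Lemma cisD (R : realType) (a b : R) : cis (a + b) = cis a * cis b.
Proof. by apply/eqP; rewrite eq_complex /= cosD sinD [sin a * _ + _]addrC !eqxx. Qed.

Lemma cis0 (R : realType) : cis (0 : R) = 1.
Proof. by rewrite /cis cos0 sin0. Qed.

Lemma cisNl (R : realType) (a : R) : cis (- a) * cis a = 1.
Proof. by rewrite -cisD addNr cis0. Qed.

Lemma cis_neq0 (R : realType) (a : R) : cis a != 0.
Proof.
by apply/eqP => a0; have /eqP := cisNl _ a; rewrite a0 mulr0 eq_sym oner_eq0.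
Qed.

Lemma cisV (R : realType) (a : R) : (cis a)^-1 = cis (- a).
Proof. by apply: (mulIf (cis_neq0 _ a)); rewrite cisNl mulVf ?cis_neq0. Qed.

Lemma cis_pihalf (R : realType) : cis (pi / 2 : R) = 'i.
Proof. by rewrite /cis cos_pihalf sin_pihalf. Qed.

Lemma conj_cis (R : realType) (a : R) : (cis a)^* = cis (- a).
Proof. by rewrite /cis cosN sinN. Qed.

Lemma norm_cis (R : realType) (a : R) : `|cis a| = 1.
Proof. by apply/eqP; rewrite -sqrp_eq1 // normCK conj_cis mulrC cisNl. Qed.

Lemma cisDpi (R : realType) (a : R) : cis (a + pi) = - cis a.
Proof. by apply/eqP; rewrite eq_complex /= cosDpi sinDpi !eqxx. Qed.

Lemma norm_real_complex (R : realType) (a : R) :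
  0 <= a -> `|a%:C : plane R| = a%:C.
Proof. by move=> a0; rewrite ger0_norm // ler0c. Qed.

(** The signed coordinate, along [cis t], of the orthogonal projection of [X] on that line. *)
Definition proj_coord {R : realType} (X : plane R) (t : R) : R :=
  complex.Re X * cos t + complex.Im X * sin t.

Lemma proj_coord_cis (R : realType) (X : plane R) (t : R) :
  X + X^* * cis t ^+ 2 = 2 * ((proj_coord X t)%:C * cis t).
Proof.
have X2 : X * cis (- t) + X^* * cis t = 2 * (proj_coord X t)%:C.
  case: X => a b; apply/eqP; rewrite eq_complex /proj_coord /cis cosN sinN /=.
  by apply/andP; split; apply/eqP; ring.
by rewrite mulrA -X2 mulrDl -[X * _ * _]mulrA cisNl; ring.
Qed.

(* The direction of the edge from [w] to [w + delta cis a] is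
   [cis (pi / 4 - a / 2)], up to a positive factor and a sign. *)
Lemma Proj_edge_dir (R : realType) (delta a : R) (u w X : plane R) :
  0 < delta -> u = w + delta%:C * cis a ->
  let t := pi / 4 - a / 2 in
  Proj X (edge_dir u w) = (proj_coord X t)%:C * cis t.
Proof.
move=> d0 -> t.
have dC : delta%:C != 0 :> plane R by rewrite eq_complex /= eqxx andbT gt_eqF.
(* [Proj] sees the direction only through its square and modulus, so the branch of [sqrtC] is
   irrelevant. Here i(w - u) = delta cis(a - pi/2) and 2t = pi/2 - a. *)
have e2 : edge_dir (w + delta%:C * cis a) w ^+ 2 = (delta%:C)^-1 * cis t ^+ 2.
  rewrite /edge_dir exprVn sqrtCK expr2 -cisD -[t + t]opprK -cisV -invfM.
  congr (_^-1); have -> : - (t + t) = a + pi / 2 + - pi by rewrite /t; field.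
  rewrite -[RHS]opprK -mulrN -cisDpi subrK cisD cis_pihalf; ring.
have n2 : `|edge_dir (w + delta%:C * cis a) w| ^+ 2 = (delta%:C)^-1.
  by rewrite -normrX e2 normrM normrX norm_cis expr1n mulr1 normfV
    norm_real_complex // ltW.
rewrite /Proj e2 n2.
have two : (2 : plane R) != 0 by rewrite pnatr_eq0.
apply: (mulfI two); rewrite -proj_coord_cis.
by field; rewrite ?dC ?two.
Qed.

Lemma Re_normsq_real_cis (R : realType) (x t : R) :
  complex.Re (`|x%:C * cis t : plane R| ^+ 2) = x ^+ 2.
Proof.
by rewrite normrM norm_cis mulr1 normCK [_^*]conjc_real -rmorphM /= -expr2.
Qed.

Lemma real_cisI (R : realType) (x y t : R) :
  x%:C * cis t = y%:C * cis t :> plane R -> x = y.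
Proof. by move/(mulIf (cis_neq0 _ t))/complexI. Qed.

Lemma proj_coordDpihalf (R : realType) (X : plane R) (t : R) :
  proj_coord X t ^+ 2 + proj_coord X (t + pi / 2) ^+ 2 =
  complex.Re X ^+ 2 + complex.Im X ^+ 2.
Proof.
rewrite /proj_coord cosDpihalf sinDpihalf.
set a := complex.Re X; set b := complex.Im X.
transitivity ((a ^+ 2 + b ^+ 2) * (cos t ^+ 2 + sin t ^+ 2)); first by ring.
by rewrite cos2Dsin2 mulr1.
Qed.

Lemma proj_coordBpi (R : realType) (X : plane R) (t : R) :
  proj_coord X (t - pi) = - proj_coord X t.
Proof.
have c := cosDpi (t - pi); have s := sinDpi (t - pi); rewrite subrK in c s.
by rewrite /proj_coord c s; ring.
Qed.

(** In the orthonormal frame at angle [s], [X] has coordinates x and z, and y = x cos(s - t) - z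
    sin(s - t). Solving for z sin(s - t) gives the formula for x^2 + z^2. *)
Lemma sqr_norm_two_projections (R : realType) (X : plane R) (s t : R) :
  let x := proj_coord X s in let y := proj_coord X t in
  sin (s - t) ^+ 2 * (complex.Re X ^+ 2 + complex.Im X ^+ 2) =
  x ^+ 2 + y ^+ 2 - 2 * (x * y) * cos (s - t).
Proof.
move=> x y.
rewrite -(proj_coordDpihalf _ X s); set z := proj_coord X (s + pi / 2).
have -> : y = x * cos (s - t) - z * sin (s - t).
  rewrite /y /x /z -{1}(subKr s t) /proj_coord cosDpihalf sinDpihalf.
  by rewrite (cosB s (s - t)) (sinB s (s - t)); ring.
by rewrite -/x sin2cos2; ring: (sin2cos2 (s - t)).
Qed.

(** * Rhombi contained in the domain *)

Lemma open_quadP (R : realType) (a b c d z : plane R) :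
  open_quad a b c d z <->
  exists x y s t : R, [/\ 0 < x, 0 < y, 0 < s & 0 < t] /\
    (x + y + s + t = 1 /\ z = x%:C * a + y%:C * b + s%:C * c + t%:C * d).
Proof.
split=> [[k [k0 k1 ->]]|[x [y [s [t [[x0 y0 s0 t0] [e1 ->]]]]]]].
  move: k1; rewrite !big_ord_recl !big_ord0 !addr0 !addrA !(tnth_nth 0) /= => k1.
  exists (k ord0), (k (lift ord0 ord0)), (k (lift ord0 (lift ord0 ord0))),
    (k (lift ord0 (lift ord0 (lift ord0 ord0)))).
  by split; [split; exact: k0|split].
exists (fun i : 'I_4 => nth 0 [:: x; y; s; t] i); split.
- by case=> [[|[|[|[|?]]]]] //=.
- by rewrite !big_ord_recl !big_ord0 !addr0 !addrA.
- by rewrite !big_ord_recl !big_ord0 !addr0 !addrA !(tnth_nth 0).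
Qed.

Lemma open_quad_swap (R : realType) (a b c d : plane R) :
  open_quad a b c d = open_quad a d c b.
Proof.
have sub b' d' : open_quad a b' c d' `<=` open_quad a d' c b'.
  move=> z /open_quadP[x [y [s [t [[x0 y0 s0 t0] [e1 ->]]]]]].
  apply/open_quadP; exists x, t, s, y; split; [by []|split; last by ring].
  by rewrite -e1; ring.
by apply/seteqP; split; exact: sub.
Qed.

Lemma open_quad_rev (R : realType) (a b c d : plane R) :
  open_quad a b c d = open_quad c b a d.
Proof.
have sub a' c' : open_quad a' b c' d `<=` open_quad c' b a' d.
  move=> z /open_quadP[x [y [s [t [[x0 y0 s0 t0] [e1 ->]]]]]].
  apply/open_quadP; exists s, y, x, t; split; [by []|split; last by ring].
  by rewrite -e1; ring.
by apply/seteqP; split; exact: sub.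
Qed.

Lemma segment_left (R : realType) (a b : plane R) : segment a b a.
Proof. by exists 0; rewrite ?lexx ?ler01 // mul0r addr0. Qed.

Lemma segment_right (R : realType) (a b : plane R) : segment a b b.
Proof. by exists 1; rewrite ?lexx ?ler01 // mul1r addrC subrK. Qed.

(** A point of the side moved slightly towards the barycenter [q] acquires four positive weights. *)
Lemma segment_sub_closure_quad (R : realType) (a b c d : plane R) :
  segment a b `<=` closure (open_quad a b c d).
Proof.
move=> p [t /andP[t0 t1] pE] B /nbhs_ballP[e /= e0 eB].
pose q : plane R := (a + b + c + d) / 4.
(* Distances and radii in [plane R] are complex numbers that happen to be real; [r] and [D] are
   their real versions. *)
pose r : R := complex.Re e; pose D : R := complex.Re `|q - p|.
have rE : e = r%:C by rewrite /r RRe_real // gtr0_real.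
have DE : `|q - p| = D%:C by rewrite /D RRe_real // normr_real.
have r0 : 0 < r by rewrite -ltcR -rE.
have D0 : 0 <= D by rewrite -lecR -DE normr_ge0.
pose s : R := Num.min 1 (r / (D + 1)).
have D1 : 0 < D + 1 by rewrite ltr_wpDl.
have s0 : 0 < s by rewrite lt_min ltr01 divr_gt0.
have s1 : s <= 1 by rewrite ge_min lexx.
have sD : s * D < r.
  have : s * (D + 1) <= r by rewrite -ler_pdivlMr // ge_min lexx orbT.
  by rewrite mulrDr mulr1; lra.
exists (p + s%:C * (q - p)); split.
  have four : (4 : plane R) != 0 by rewrite pnatr_eq0.
  apply/open_quadP; exists ((1 - s) * (1 - t) + s / 4), ((1 - s) * t + s / 4),
    (s / 4), (s / 4).
  have s4 : 0 < s / 4 by rewrite divr_gt0.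
  have h1 : 0 <= (1 - s) * (1 - t) by rewrite mulr_ge0 // subr_ge0.
  have h2 : 0 <= (1 - s) * t by rewrite mulr_ge0 // subr_ge0.
  split; first by split; rewrite ?ltr_wpDl.
  split; first by field.
  rewrite pE /q !rmorphD !rmorphM !rmorphB !rmorph1 fmorphV rmorph_nat.
  by field.
apply: eB; rewrite /ball /= opprD addNKr normrN normrM DE rE.
by rewrite norm_real_complex ?(ltW s0) // -rmorphM ltcR.
Qed.

Lemma rhombus_sym (R : realType) (G : plane_graph R) (delta : R)
    (u w u' w' : plane R) :
  rhombus G delta u w u' w' -> rhombus G delta u' w u w'.
Proof.
have sym v a b : incident_face G delta v a b -> incident_face G delta v b a.
  by move=> [n [x [s [fx xs]]]]; exists n, x, s; split=> //; case: xs; [right|left].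
by move=> [h h' ne]; split=> //; exact: sym.
Qed.

Lemma rhombus_dual_sym (R : realType) (G : plane_graph R) (delta : R)
    (u w u' w' : plane R) :
  rhombus G delta u w u' w' -> rhombus G delta u w' u' w.
Proof. by move=> [h h' ne]; split=> //; exact: nesym. Qed.

(** A cutting diagonal would lie on the boundary, yet each diagonal has an interior endpoint, [u] or
    [w]. An empty intersection is impossible because the interior point [w] is in the closure of the
    rhombus. *)
Lemma open_quad_sub_domain (R : realType) (G : plane_graph R) (delta : R)
    (Om : set (plane R)) (u w u' w' : plane R) :
  discrete_domain G delta Om -> rhombus G delta u w u' w' ->
  interior Om u -> interior Om w -> interior Om u' ->
  open_quad u w u' w' `<=` Om.
Proof.
move=> [_ tOm _] rh iu iw iu'.
have nb x y z : interior Om x -> segment y z x -> ~ segment y z `<=` boundary Om.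
  by move=> ix sx /(_ _ sx)[_].
have sl := @segment_left R; have sr := @segment_right R.
case: (tOm _ _ _ _ rh) => // [Q0|[]|[]].
- have [p [Qp Omp]] := segment_sub_closure_quad _ u w u' w' w (sr u w) Om iw.
  by have : set0 p by rewrite -Q0.
- by move=> [_ /(nb _ _ _ iw (sl w w'))].
- by move=> [_ /(nb _ _ _ iw (sl w w'))].
- by move=> [_ /(nb _ _ _ iu (sl u u'))].
- by move=> [_ /(nb _ _ _ iu (sl u u'))].
Qed.

Lemma tile_side_of_sub (R : realType) (G : plane_graph R) (delta : R)
    (Om : set (plane R)) (u w u' w' : plane R) :
  rhombus G delta u w u' w' -> open_quad u w u' w' `<=` Om ->
  tile_side G delta Om (Defs.center u u') u w.
Proof.
move=> rh QOm; exists u', w'; split=> //.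
  split=> //.
  have [p [Qp _]] :=
    segment_sub_closure_quad _ u w u' w' u (segment_left _ u w) setT filterT.
  by exists p; split=> //; exact: QOm.
by rewrite /tile (setIidl QOm); exact: segment_sub_closure_quad.
Qed.

(** * The fourth vertex of a rhombus *)

Lemma incident_face_norm (R : realType) (G : plane_graph R) (delta : R)
    (w u u' : plane R) :
  0 < delta -> incident_face G delta w u u' ->
  `|u - w| = delta%:C /\ `|u' - w| = delta%:C.
Proof.
move=> d0 [n [v [s [[_ _ [a [_ _ vE]] _] uv]]]].
have nv t : `|v t - w| = delta%:C.
  by rewrite vE addrC addKr normrM norm_cis mulr1 norm_real_complex // ltW.
by case: uv => -[<- <-]; rewrite !nv.
Qed.

(** Two circles of equal radius through [u] and [u'] have centers symmetric about the midpoint. With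
    [w] as origin, the four norm equations become polynomial identities in p, q, d and their
    conjugates. *)
Lemma circle_centers_sym (R : realType) (r u u' w w' : plane R) :
  0 < r -> u != u' -> w != w' ->
  `|u - w| = r -> `|u' - w| = r -> `|u - w'| = r -> `|u' - w'| = r ->
  w' = u + u' - w.
Proof.
move=> r0 uu' ww' h1 h2 h3 h4.
have sq x : `|x| = r -> x * x^* = r ^+ 2 by rewrite -normCK => ->.
set p := u - w in h1; set q := u' - w in h2; set d := w' - w.
have pd : u - w' = p - d by rewrite /p /d; ring.
have qd : u' - w' = q - d by rewrite /q /d; ring.
have pq0 : p - q != 0.
  by rewrite /p /q opprB addrA subrK subr_eq0.
have d0 : d != 0 by rewrite subr_eq0 eq_sym.
have r20 : r ^+ 2 != 0 by rewrite expf_neq0 // gt_eqF.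
move: (sq _ h1) (sq _ h2) (sq _ h3) (sq _ h4).
rewrite pd qd [(p - d)^*]rmorphB [(q - d)^*]rmorphB /=.
set P := p^*; set Q := q^*; set D := d^*.
move=> pP qQ pdE qdE.
have E1 : p * D + P * d = d * D.
  apply/eqP; rewrite -subr_eq0.
  have -> : p * D + P * d - d * D = p * P - (p - d) * (P - D) by ring.
  by rewrite pdE pP subrr.
have E2 : q * D + Q * d = d * D.
  apply/eqP; rewrite -subr_eq0.
  have -> : q * D + Q * d - d * D = q * Q - (q - d) * (Q - D) by ring.
  by rewrite qdE qQ subrr.
(* The difference of [E1] and [E2], multiplied by pq, has the factor p - q. *)
have E3 : p * q * D = r ^+ 2 * d.
  apply: (mulfI pq0); apply/eqP; rewrite -subr_eq0.
  have -> : (p - q) * (p * q * D) - (p - q) * (r ^+ 2 * d) =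
      p * q * (p * D + P * d - (q * D + Q * d))
      + (r ^+ 2 - p * P) * q * d - (r ^+ 2 - q * Q) * p * d by ring.
  by rewrite E1 E2 pP qQ !subrr !(mul0r, mulr0) addr0 subr0.
have E4 : d = p + q.
  apply/eqP; rewrite -subr_eq0.
  have : r ^+ 2 * d * (d - (p + q)) = 0.
    have : p * q * (d * D - (p * D + P * d)) = 0 by rewrite E1 subrr mulr0.
    have -> : p * q * (d * D - (p * D + P * d)) =
        d * (p * q * D) - p * (p * q * D) - p * P * q * d by ring.
    by rewrite E3 pP => <-; ring.
  by move/eqP; rewrite mulf_eq0 (mulf_eq0 (r ^+ 2)) (negPf r20) (negPf d0).
by rewrite -(subrK w w') -/d E4 /p /q; ring.
Qed.

(** Hence u - w' = w - u', which gives the direction of the side [u w'] from the argument of [u']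
    around [w]. *)
Lemma rhombus_opposite (R : realType) (G : plane_graph R) (delta : R)
    (u w u' w' : plane R) :
  0 < delta -> u != u' -> rhombus G delta u w u' w' -> w' = u + u' - w.
Proof.
move=> d0 uu' [/(incident_face_norm _ _ _ _ _ _ d0)[h1 h2]].
move=> /(incident_face_norm _ _ _ _ _ _ d0)[h3 h4] /eqP ww'.
by apply: circle_centers_sym h1 h2 h3 h4; rewrite // ltcR.
Qed.

(** * Angles around a face *)

(** The extra value [A n.+3] closes the turn, so that the last gap is treated like the others. *)
Lemma cyclic_on_circle_angles (R : realType) (delta : R) (w : plane R) (n : nat)
    (u : 'I_n.+3 -> plane R) :
  cyclic_on_circle delta w u ->
  exists A : nat -> R,
    [/\ forall i j, (i < j <= n.+3)%N -> A i < A j,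
        A n.+3 = A 0%N + 2 * pi &
        forall s : 'I_n.+3, u s = w + delta%:C * cis (A s)].
Proof.
move=> [a [amono alast uE]].
exists (fun i => if (i < n.+3)%N then a (inord i) else a ord0 + 2 * pi).
split.
- move=> i j /andP[ij jn].
  have iN : (i < n.+3)%N by apply: leq_trans jn.
  rewrite iN; case: ifPn => [jN|_]; first by apply: amono; rewrite !inordK.
  have [ilt|ige] := ltnP i n.+2.
    by apply: lt_trans alast; apply: amono; rewrite inordK.
  suff -> : inord i = ord_max :> 'I_n.+3 by [].
  by apply: val_inj; rewrite /= inordK //; apply/eqP; rewrite eqn_leq ige andbT.
- by rewrite ltnn ltn0Sn; congr (a _ + _); apply: val_inj; rewrite /= inordK.
- by move=> s; rewrite ltn_ord inord_val uE.
Qed.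

Lemma cisD2pi (R : realType) (a : R) : cis (a + 2 * pi) = cis a.
Proof. by rewrite mulr_natl mulr2n addrA !cisDpi opprK. Qed.

Lemma Im_sum (R : realType) (n : nat) (f : 'I_n -> plane R) :
  complex.Im (\sum_(i < n) f i) = \sum_(i < n) complex.Im (f i).
Proof.
elim/big_rec2: _ => [|i x y _ <-]; first by [].
by case: (f i) y => a b [c d].
Qed.

(* Were a gap at least [pi], all vertices would lie on one side of a line
   through [w], at least one of them strictly. *)
Lemma gap_lt_pi (R : realType) (delta : R) (w : plane R) (n : nat)
    (u : 'I_n.+3 -> plane R) (A : nat -> R) :
  0 < delta -> open_hull u w ->
  (forall i j, (i < j <= n.+3)%N -> A i < A j) ->
  A n.+3 = A 0%N + 2 * pi ->
  (forall s : 'I_n.+3, u s = w + delta%:C * cis (A s)) ->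
  forall s, (s < n.+3)%N -> A s.+1 - A s < pi.
Proof.
move=> d0 [c [c0 c1 wE]] Amono AN uE s sN.
have Amono' i j : (i <= j <= n.+3)%N -> A i <= A j.
  move=> /andP[]; rewrite leq_eqVlt => /predU1P[->//|ij jn].
  by apply/ltW/Amono; rewrite ij.
have dC : delta%:C != 0 :> plane R by rewrite eq_complex /= eqxx andbT gt_eqF.
have sum0 : \sum_(i < n.+3) (c i)%:C * cis (A i) = 0 :> plane R.
  apply: (mulfI dC); rewrite mulr0 mulr_sumr.
  apply: (addrI w); rewrite addr0 {2}wE.
  have w1 : w = \sum_(i < n.+3) (c i)%:C * w.
    by rewrite -mulr_suml -rmorph_sum c1 rmorph1 mul1r.
  rewrite {1}w1 -big_split; apply: eq_bigr => i _ /=.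
  by rewrite uE mulrDr; congr (_ + _); rewrite mulrCA.
have sin0 g : \sum_(i < n.+3) c i * sin (A i - g) = 0.
  have : complex.Im ((\sum_(i < n.+3) (c i)%:C * cis (A i)) * cis (- g)) = 0.
    by rewrite sum0 mul0r.
  rewrite mulr_suml Im_sum => h; rewrite -[RHS]h; apply: eq_bigr => i _.
  by rewrite -mulrA -cisD /= mul0r addr0.
rewrite ltNge; apply/negP => gap.
have hlast : A s.+1 <= A 0%N + 2 * pi.
  by rewrite -AN; apply: Amono'; rewrite leqnn andbT.
have hA0 (i : nat) : (i <= n.+3)%N -> A 0%N <= A i by move=> iN; apply: Amono'.
have sinE (i : nat) : sin (A i - A s.+1) = sin (A i - A s.+1 + 2 * pi).
  by rewrite mulr_natl sinD2pi.
(* Modulo 2 pi all arguments lie between [A s.+1] and [A s + 2 * pi], an arc of length at most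
   pi. *)
have ge0 (i : 'I_n.+3) : 0 <= sin (A i - A s.+1).
  have h0 := hA0 _ (ltnW (ltn_ord i)).
  have [si|is_] := ltnP s i.
    have h1 : A s.+1 <= A i by apply: Amono'; rewrite si ltnW.
    have h2 : A i <= A n.+3 by apply: Amono'; rewrite leqnn ltnW.
    have h3 := hA0 _ (ltnW sN).
    by apply: sin_ge0_pi; rewrite AN in h2; lra.
  have h1 : A i <= A s by apply: Amono'; rewrite is_ ltnW.
  by rewrite sinE; apply: sin_ge0_pi; lra.
(* The vertex two places after [s], strictly inside this arc: its index is s + 2, 0 or 1 according
   to the wrap-around. *)
have [i gt0] : exists i : 'I_n.+3, 0 < sin (A i - A s.+1).
  have [h|h] := ltnP s.+2 n.+3.
    exists (Ordinal h).
    have h1 : A s.+1 < A s.+2 by apply: Amono; rewrite ltnSn ltnW.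
    have h2 : A s.+2 < A n.+3 by apply: Amono; rewrite h leqnn.
    have h3 := hA0 _ (ltnW sN).
    by apply: sin_gt0_pi; rewrite AN in h2; rewrite /=; lra.
  move: (h); rewrite leq_eqVlt => /predU1P[sE|sE].
    have s1 : s = n.+1 by case: sE => <-.
    exists ord0; rewrite sinE /=; apply: sin_gt0_pi.
    have h1 : A s.+1 < A n.+3 by apply: Amono; rewrite s1 leqnn andbT.
    have h2 : A 0%N < A s by apply: Amono; rewrite s1 (leqW (leqnSn _)).
    rewrite AN in h1; lra.
  have s2 : s = n.+2 by apply/eqP; rewrite eqn_leq -ltnS sN -ltnS.
  exists (Ordinal (isT : (1 < n.+3)%N)); rewrite sinE /=; apply: sin_gt0_pi.
  have h1 : A 0%N < A 1%N by apply: Amono.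
  have h2 : A 1%N < A s by apply: Amono; rewrite s2 leqnSn.
  rewrite s2 AN in gap h2 *; lra.
have := sin0 (A s.+1); apply/eqP; rewrite gt_eqF // (bigD1 i) //=.
by rewrite ltr_pwDl ?mulr_gt0 ?sumr_ge0 // => j _; rewrite mulr_ge0 // ltW.
Qed.

Lemma angle_cis (R : realType) (delta a b : R) :
  0 < delta -> 0 <= b - a <= pi ->
  angle (delta%:C * cis a) (delta%:C * cis b) = b - a.
Proof.
move=> d0 ab; rewrite /angle !normrM !norm_cis !mulr1 norm_real_complex ?ltW //.
have dC : delta%:C != 0 :> plane R by rewrite eq_complex /= eqxx andbT gt_eqF.
have -> : delta%:C * cis a * (delta%:C * cis b)^* / (delta%:C * delta%:C) =
    cis (a - b).
  rewrite rmorphM /= conj_cis [delta%:C^*]conjc_real cisD.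
  by field.
by rewrite /cis /= cosKN; lra.
Qed.

(** * The estimate around an inner face *)

Theorem proposition3p8 (R : realType) (eta : R) (eta_gt0 : 0 < eta) :
  exists C : R, 0 < C /\
    forall (delta : R) (G : plane_graph R) (Om : set (plane R))
           (F : plane R -> plane R) (H : plane R -> R)
           (n : nat) (w : plane R) (u wn : 'I_n.+3 -> plane R),
      0 < delta ->
      isoradial G delta ->
      rhombi_angles_in G delta eta (pi - eta) ->
      discrete_domain G delta Om ->
      simply_connected Om ->
      inscribed_face G delta w u ->
      int_dom_dual G delta Om w ->
      (forall s, int_dom_vertex G delta Om (u s)) ->
      (forall s, rhombus G delta (u s) w (u (ordS s)) (wn s)) ->
      (forall s, dom_dual G delta Om (wn s)) ->
      s_holomorphic G delta Om F ->
      primitive_of_square G delta Om F H ->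
      \big[Num.max/H (u ord0)]_(s < n.+3) H (u s) - H w <=
        C * (H w - \big[Num.min/H (wn ord0)]_(s < n.+3) H (wn s)).
Proof.
(* Since [eta] may be arbitrarily large, it is capped to keep sin(e / 2) positive. *)
pose e : R := Num.min eta 1.
have e0 : 0 < e by rewrite lt_min eta_gt0 ltr01.
have e_eta : e <= eta by rewrite ge_min lexx.
have e1 : e <= 1 by rewrite ge_min lexx orbT.
have pi2 : 2 <= pi :> R by exact: pi_ge2.
pose c : R := sin (e / 2).
have c0 : 0 < c by apply: sin_gt0_pi; lra.
pose L := 6 / c ^+ 2.
have L1 : 1 <= L.
  have c1 : c ^+ 2 <= 1 by apply: exprn_ile1; [exact: ltW|exact: sin_le1].
  by rewrite ler_pdivlMr ?exprn_gt0 // mul1r; lra.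
(* [K] will bound the number of vertices of the face, which frees the constant from [n]. *)
pose K := Num.bound (2 * pi / e).
exists (L ^+ (2 * K).+1); split; first by rewrite exprn_gt0 // (lt_le_trans ltr01).
move=> delta G Om F H n w u wn d0 _ angles dom _ face [_ iw] iu rh _ shol prim.
have [_ edges circ hull] := face.
have [A [Amono AN uE]] := cyclic_on_circle_angles _ _ _ _ _ circ.
pose o (t : nat) : 'I_n.+3 := Ordinal (ltn_pmod t (isT : (0 < n.+3)%N)).
have oS t : ordS (o t) = o t.+1.
  by apply: val_inj; rewrite /= -addn1 modnDml addn1.
have oN : o n.+3 = o 0%N by apply: val_inj; rewrite /= modnn mod0n.
have o_ord (s : 'I_n.+3) : o s = s by apply: val_inj; rewrite /= modn_small.
have uA t : (t <= n.+3)%N -> u (o t) = w + delta%:C * cis (A t).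
  rewrite leq_eqVlt => /predU1P[->|tN]; first by rewrite oN AN cisD2pi uE.
  by rewrite uE /= modn_small.
have rht t : rhombus G delta (u (o t)) w (u (o t.+1)) (wn (o t)).
  by rewrite -oS; exact: rh.
have wnE t : wn (o t) = u (o t) + u (o t.+1) - w.
  apply: rhombus_opposite d0 _ (rht t); apply/eqP => uu.
  by apply: (@edge_irr _ G (u (o t))); rewrite {2}uu -oS; exact: edges.
pose z t := Defs.center (u (o t)) (u (o t.+1)).
have QOm t : open_quad (u (o t)) w (u (o t.+1)) (wn (o t)) `<=` Om.
  have [[_ iut] [_ iut']] := (iu (o t), iu (o t.+1)).
  exact: open_quad_sub_domain dom (rht t) iut iw iut'.
have side1 t : tile_side G delta Om (z t) (u (o t)) w.
  exact: tile_side_of_sub (rht t) (QOm t).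
have side2 t : tile_side G delta Om (z t) (u (o t.+1)) w.
  rewrite /z /Defs.center addrC.
  apply: tile_side_of_sub (rhombus_sym _ _ _ _ _ _ _ (rht t)) _.
  by rewrite open_quad_rev; exact: QOm.
have side3 t : tile_side G delta Om (z t) (u (o t)) (wn (o t)).
  apply: tile_side_of_sub (rhombus_dual_sym _ _ _ _ _ _ _ (rht t)) _.
  by rewrite open_quad_swap; exact: QOm.
have gap t : (t < n.+3)%N -> e <= A t.+1 - A t <= pi - e.
  move=> tN.
  have lt1 : A t < A t.+1 by apply: Amono; rewrite ltnSn.
  (* [angle] is an arccosine: it equals the gap, and not 2 pi minus the gap, because the gap is
     below pi. *)
  have lt2 := gap_lt_pi _ _ _ _ _ _ d0 hull Amono AN uE _ tN.
  have [] := angles _ _ _ _ (rht t).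
  rewrite !uA // ?(ltnW tN) // ![w + _ - w]addrC !addKr angle_cis //; last lra.
  by move=> ? _; lra.
pose b t := pi / 4 - A t / 2.
pose x t := proj_coord (F (z t)) (b t).
have xS t : (t < n.+3)%N -> proj_coord (F (z t)) (b t.+1) = x t.+1.
  move=> tN; have := shol _ _ _ _ (side2 t) (side1 t.+1).
  by rewrite !(Proj_edge_dir _ _ _ _ _ _ d0 (uA _ tN)); exact: real_cisI.
(* After a full turn the rhombus is the first one again, while [b] has dropped by pi. *)
have xN : x n.+3 = - x 0%N.
  have -> : x n.+3 = proj_coord (F (z 0%N)) (b 0%N - pi).
    rewrite /x /z oN; congr (proj_coord (F (Defs.center _ (u _))) _).
      by rewrite -oS oN oS.
    by rewrite /b AN; field.
  exact: proj_coordBpi.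
have Hu t : (t <= n.+3)%N -> H (u (o t)) - H w = 2 * delta * x t ^+ 2.
  move=> tN; rewrite (prim _ _ _ (side1 t)).
  by rewrite (Proj_edge_dir _ _ _ _ _ _ d0 (uA _ tN)) Re_normsq_real_cis.
have Hw t : (t < n.+3)%N -> H (u (o t)) - H (wn (o t)) =
    2 * delta *
    (complex.Re (F (z t)) ^+ 2 + complex.Im (F (z t)) ^+ 2 - x t.+1 ^+ 2).
  move=> tN; rewrite (prim _ _ _ (side3 t)).
  (* Seen from [wn (o t)], [u (o t)] has argument [A t.+1 + pi]; the resulting direction is
     [b t.+1 - pi / 2], orthogonal to that of [x t.+1]. *)
  have uwn : u (o t) = wn (o t) + delta%:C * cis (A t.+1 + pi).
    by rewrite cisDpi mulrN wnE (uA t.+1 tN); ring.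
  rewrite (Proj_edge_dir _ _ _ _ _ _ d0 uwn) Re_normsq_real_cis -xS //.
  rewrite -(proj_coordDpihalf _ (F (z t)) (pi / 4 - (A t.+1 + pi) / 2)).
  have -> : pi / 4 - (A t.+1 + pi) / 2 + pi / 2 = b t.+1 by rewrite /b; field.
  by rewrite addrK.
set m := H w - _.
pose M := m / (2 * delta).
have d20 : 0 < 2 * delta by rewrite mulr_gt0.
have hm t : H w - H (wn (o t)) <= m.
  by rewrite lerB // bigmin_le.
have [M0 bnd] : 0 <= M /\
    forall t, (t <= n.+3)%N -> x t ^+ 2 <= L ^+ (2 * n.+3).+1 * M.
  apply: (@antiperiodic_bound _ c M n.+3 x (fun t => cos (b t - b t.+1))
    (fun t => sin (b t - b t.+1))) => // t tN.
  have bE : b t - b t.+1 = (A t.+1 - A t) / 2 by rewrite /b; field.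
  have /andP[g1 g2] := gap _ tN.
  split.
  (* The half-gap is at most pi/2 - e/2, whose cosine is [c]. *)
  - rewrite /c -cosBpihalf -cosN opprB bE leNgt ltr_cos ?in_itv /= -?leNgt; lra.
  - by apply: sin_gt0_pi; rewrite bE; lra.
  - exact: cos2Dsin2.
  have key : complex.Re (F (z t)) ^+ 2 + complex.Im (F (z t)) ^+ 2
      - x t ^+ 2 - x t.+1 ^+ 2 <= M.
    rewrite ler_pdivlMr //; apply: le_trans (hm t).
    have := Hu _ (ltnW tN); have := Hw _ tN; lra.
  have S2 := sqr_ge0 (sin (b t - b t.+1)).
  apply: le_trans (ler_wpM2r S2 key); rewrite [leRHS]mulrC.
  have := sqr_norm_two_projections _ (F (z t)) (b t) (b t.+1).
  rewrite /= xS // -/(x t) => E.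
  by rewrite [leRHS]mulrBr [X in _ <= X - _]mulrBr E sin2cos2; lra.
(* The gaps are at least [e] and add up to 2 pi. *)
have NK : (n.+3 <= K)%N.
  have tele t : (t <= n.+3)%N -> t%:R * e <= A t - A 0%N.
    elim: t => [|t IH] tN; first by rewrite mul0r subrr.
    have := IH (ltnW tN); have /andP[] := gap _ tN.
    by rewrite mulrSr mulrDl mul1r; lra.
  have := tele _ (leqnn _); rewrite AN => h.
  rewrite -(ler_nat R); apply/ltW.
  apply: le_lt_trans (archi_boundP _); last by rewrite divr_ge0 //; lra.
  by rewrite ler_pdivlMr //; lra.
have Hmax s : H (u s) <= H w + L ^+ (2 * K).+1 * m.
  rewrite -(o_ord s) -lerBlDl Hu ?(ltnW (ltn_ord _)) //.
  have -> : m = M * (2 * delta) by rewrite /M divfK // gt_eqF.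
  rewrite [leLHS]mulrC [leRHS]mulrA ler_pM2r //.
  apply: le_trans (bnd _ (ltnW (ltn_ord s))) _.
  by rewrite ler_wpM2r // ler_weXn2l // ltnS leq_mul2l.
by rewrite lerBlDl; apply: bigmax_le => // s _; exact: Hmax.
Qed.
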